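(* Let $n\ge 1$ and let $X_1,\dots,X_n$ be independent random variables with $X_i\sim\mathrm{Ber}(p_i)$, where $p_i\in[0,1]$ for $i=1,\dots,n$. Let $G(p_i,\lambda)=\mathbb{E}\left[e^{\lambda (X_i-p_i)\log p_i}\right]$ be the moment generating function of $(X_i-p_i)\log p_i$. Then for every $i$ and every real $\lambda$ with $|\lambda|<1$, $$G(p_i,\lambda)\le \exp\left\{\frac{\lambda^2}{2(1-|\lambda|)}\right\}.$$ Furthermore, for all $t>0$, $$\mathbb{P}\left(\left|\sum_{i=1}^n (X_i-p_i)\log p_i\right|\ge t\right)\le 2\exp\left\{-\frac{t^2}{2(n+t)}\right\}.$$
   Context: $\mathrm{Ber}(p)$ denotes the Bernoulli distribution: the variable takes the value $1$ with probability $p$ and $0$ with probability $1-p$. $\log$ is the natural logarithm. The convention $0\log 0=0$ is used, so that when $p_i=0$ or $p_i=1$ the variable $(X_i-p_i)\log p_i$ equals $0$ almost surely (and its moment generating function is identically $1$). *)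

(* Defs.v *)
From HB Require Import structures.
From mathcomp Require Export all_boot all_order all_algebra.
From mathcomp Require Export all_classical all_reals all_analysis.

Set Implicit Arguments.
Unset Strict Implicit.
Unset Printing Implicit Defensive.

Import Order.TTheory GRing.Theory Num.Theory.
Import numFieldNormedType.Exports.

Local Open Scope classical_set_scope.
Local Open Scope ring_scope.

(* The law is transported from the library's [bernoulli_prob], which lives on
   [bool], along true |-> 1, false |-> 0. For p outside [0, 1]
   [bernoulli_prob p] is the Dirac mass at false, so users must assume
   0 <= p <= 1. *)
Definition is_Ber (d : measure_display) (T : measurableType d) (R : realType)
    (P : probability T R) (X : {RV P >-> R}) (p : R) : Prop :=
  forall A : set R, measurable A ->
    distribution P X A = pushforward (bernoulli_prob p) (fun b : bool => b%:R : R) A.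

Definition mutually_independent (d : measure_display) (T : measurableType d)
    (R : realType) (P : probability T R) (I : finType)
    (X : I -> {RV P >-> R}) : Prop :=
  forall (J : {set I}) (A : I -> set R),
    (forall i, i \in J -> measurable (A i)) ->
    P (\bigcap_(i in [set` J]) (X i @^-1` A i)) =
      (\prod_(i in J) P (X i @^-1` A i))%E.

(* The library's [ln] satisfies ln 0 = 0, so for p = 0 (and for p = 1) this is
   identically 0, in accordance with the convention 0 log 0 = 0. *)
Definition centered_log (T : Type) (R : realType) (X : T -> R) (p : R) : T -> R :=
  fun w => (X w - p) * ln p.

(* Main.v *)
(* With a = - log p and s = |l|, the two values x of l (X - p) log p satisfy
   |x| <= s a, so exp x <= 1 + x + x^2 (2 + exp (s a)) / 6. Taking expectations,
   the linear term vanishes and the quadratic one is controlled by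
   y^2 exp (- y) <= 16/25 applied to y = a and to y = (1 - s) a; this suffices
   for s <= 3/4, while for s > 3/4 the right-hand side exceeds 2, a trivial bound
   for the moment generating function. The tail bound is Chernoff's method with
   l = t / (n + t), carried out as a finite sum over {0, 1}^n. *)
Require Import Defs.
From mathcomp Require Import all_boot all_order all_algebra.
From mathcomp Require Import all_classical all_reals all_analysis.
(* all_analysis leaves the measurable structure of \bar R uninferable; a
   second import of measurable_realfun restores it. *)
From mathcomp Require Import measurable_realfun ring lra.
Set Implicit Arguments.
Unset Strict Implicit.
Unset Printing Implicit Defensive.
Import Order.TTheory GRing.Theory Num.Theory.
Import numFieldNormedType.Exports.
Local Open Scope classical_set_scope.
Local Open Scope ring_scope.

(** * Elementary inequalities for the exponential *)

Lemma is_derive_ge0_ge0 (R : realType) (f f' : R -> R) (x : R) :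
  f 0 = 0 -> (forall y : R, is_derive y (1 : R) f (f' y)) ->
  (forall y, 0 <= y -> 0 <= f' y) -> 0 <= x -> 0 <= f x.
Proof.
move=> f0 df f'0 x0; rewrite -f0.
apply: (@ger0_derive1_ndecry _ f 0) => //.
- move=> y; rewrite in_itv/= andbT => /ltW/f'0.
  by rewrite derive1E derive_val.
- by apply: derivable_within_continuous => y _.
Qed.

Lemma expRN_le_quad (R : realType) (x : R) : 0 <= x ->
  expR (- x) <= 1 - x + x ^+ 2 / 2.
Proof.
move=> x0; rewrite -subr_ge0.
apply: (@is_derive_ge0_ge0 _ (fun x => 1 - x + x ^+ 2 / 2 - expR (- x))
  (fun x => expR (- x) - (1 - x))) => //.
- by rewrite oppr0 expR0; lra.
- move=> y; apply: is_derive_eq.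
  by rewrite /GRing.scale /=; field.
- by move=> y _; rewrite subr_ge0 expR_ge1Dx.
Qed.

(** The weight [(2 + expR x) / 3] comes from the integral Taylor remainder [x ^+ 2] times the
    integral of [(1 - u) * expR (u * x)] over [[0, 1]], with [expR (u * x)] replaced by its chord
    [1 - u + u * expR x]. The proof differentiates twice instead: the difference of the two sides
    and its derivative [g] both vanish at 0. *)
Lemma expR_le_quad (R : realType) (x : R) : 0 <= x ->
  expR x <= 1 + x + x ^+ 2 / 2 * ((2 + expR x) / 3).
Proof.
move=> x0; rewrite -subr_ge0.
pose g (y : R) := y * (2 + expR y) / 3 + y ^+ 2 / 6 * expR y + 1 - expR y.
have g0 y : 0 <= y -> 0 <= g y.
  apply: (@is_derive_ge0_ge0 _ g
    (fun y => 2 / 3 * (1 - (1 - y) * expR y) + y ^+ 2 / 6 * expR y)).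
  - by rewrite /g expR0; lra.
  - move=> z; rewrite /g; apply: is_derive_eq.
    by rewrite /GRing.scale /=; field.
  (* The derivative of [g] is nonnegative because [1 - z <= expR (- z)]. *)
  - move=> z z0; rewrite addr_ge0 ?mulr_ge0 ?expR_ge0 ?subr_ge0 ?sqr_ge0 //.
    by rewrite -ler_pdivlMr ?expR_gt0// div1r -expRN expR_ge1Dx.
apply: (@is_derive_ge0_ge0 _
  (fun x => 1 + x + x ^+ 2 / 2 * ((2 + expR x) / 3) - expR x) g) => //.
- by rewrite expR0; lra.
- move=> y; apply: is_derive_eq.
  by rewrite /g /GRing.scale /=; field.
Qed.

(** For negative [x] the plain second-order bound is enough, since the weight [(2 + expR c) / 3] is
    at least 1. *)
Lemma expR_le_quad_norm (R : realType) (x c : R) : `|x| <= c ->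
  expR x <= 1 + x + x ^+ 2 / 2 * ((2 + expR c) / 3).
Proof.
move=> xc; have x2 : 0 <= x ^+ 2 := sqr_ge0 x.
have [x0|/ltW x0] := leP 0 x.
  apply: le_trans (expR_le_quad x0) _; rewrite ger0_norm// in xc.
  have : expR x <= expR c by rewrite ler_expR.
  by nra.
have c0 : 0 <= c := le_trans (normr_ge0 x) xc.
have e1 : 1 <= expR c by rewrite -expR0 ler_expR.
have := @expRN_le_quad _ (- x); rewrite opprK oppr_ge0 sqrrN => /(_ x0).
by nra.
Qed.

(** This is the tangent line at 1, [expR 1 * x <= expR x], with 5/2 as a rational lower bound for
    [expR 1], obtained from [(1 + 1/8) ^+ 8]. *)
Lemma expR_ge_linear (R : realType) (x : R) : 5 / 2 * x <= expR x.
Proof.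
have e8 : 9 / 8 <= expR (8^-1 : R) by have := expR_ge1Dx (8^-1 : R); lra.
have e1 : 5 / 2 <= expR (1 : R).
  have -> : (1 : R) = 8^-1 * 8%:R by field.
  rewrite expRM_natr.
  have : (9 / 8) ^+ 8 <= expR (8^-1 : R) ^+ 8 by apply: lerXn2r => //; rewrite nnegrE; lra.
  by apply: le_trans; rewrite !exprS expr0; lra.
have := expR_ge1Dx (x - 1); rewrite [1 + _]addrC subrK => xe.
rewrite (_ : expR x = expR 1 * expR (x - 1)); last by rewrite -expRD; congr expR; ring.
have [x0|x0] := leP 0 x; first by nra.
apply: (@le_trans _ _ 0); first by lra.
by rewrite mulr_ge0 ?expR_ge0.
Qed.

Lemma sqrM_expRN_le (R : realType) (x : R) : 0 <= x ->
  x ^+ 2 * expR (- x) <= 16 / 25.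
Proof.
move=> x0; rewrite expRN ler_pdivrMr ?expR_gt0//.
rewrite (_ : expR x = expR (x / 2) ^+ 2); last first.
  by rewrite -expRM_natr; congr expR; field.
have := expR_ge_linear (x / 2); nra.
Qed.

(** * The moment generating function of a single variable *)

Lemma ber_log_mgf_le (R : realType) (a l : R) : 0 <= a -> `|l| < 1 ->
  expR (- a) * expR (- (l * a * (1 - expR (- a)))) +
  (1 - expR (- a)) * expR (l * a * expR (- a)) <=
  expR (l ^+ 2 / (2 * (1 - `|l|))).
Proof.
move=> a0 l1; set p := expR (- a); set q := 1 - p; set s := `|l|.
have p0 : 0 < p := expR_gt0 _.
have p1 : p <= 1 by rewrite /p expR_le1 oppr_le0.
have s0 : 0 <= s := normr_ge0 _.
have ls : l ^+ 2 = s ^+ 2 by rewrite /s real_normK// num_real.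
pose r := 1 - s.
have r0 : 0 < r by rewrite subr_gt0.
rewrite -/r; apply: le_trans (expR_ge1Dx _).
have [rs|rb] := ltP r (1 / 4).
  apply: (@le_trans _ _ 2); last first.
    suff : 1 <= l ^+ 2 / (2 * r) by lra.
    by rewrite ler_pdivlMr ?mulr_gt0// ls mul1r /r in rs *; nra.
  have [l0|/ltW l0] := leP 0 l.
    have ap : a * p <= 2 / 5.
      rewrite /p expRN ler_pdivrMr ?expR_gt0//.
      by have := expR_ge_linear a; lra.
    have lap : l * a * p <= 2 / 5.
      have := mulr_ge0 a0 (ltW p0); rewrite /s ger0_norm// in l1; nra.
    have e1 : expR (- (l * a * q)) <= 1.
      by rewrite expR_le1 oppr_le0 !mulr_ge0// subr_ge0.
    have e2 : expR (l * a * p) <= 2.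
      have := expR_ge1Dx (- (l * a * p)).
      rewrite expRN => h.
      (* From [1 - l * a * p <= expR (- (l * a * p))], whose left side is at least 1 - 2/5. *)
      have : (3 / 5) * expR (l * a * p) <= 1.
        rewrite -ler_pdivlMr ?expR_gt0// div1r; lra.
      by lra.
    by rewrite /q in e1 *; nra.
  (* For negative [l] the exponential alone is unbounded in [a]; the factor [p] absorbs it, the
     total exponent being [- a * (1 + l * q)]. *)
  have e1 : p * expR (- (l * a * q)) <= 1.
    rewrite /p -expRD expR_le1.
    have : - l * q <= 1 by rewrite /s ler0_norm// /q in l1 *; nra.
    by nra.
  have e2 : expR (l * a * p) <= 1.
    by rewrite expR_le1 -mulrA mulr_le0_ge0// mulr_ge0// ltW.
  by rewrite /q in e1 *; nra.
have q0 : 0 <= q by rewrite subr_ge0.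
have n1 : `|- (l * a * q)| <= s * a.
  rewrite normrN !normrM (ger0_norm a0) (ger0_norm q0) -/s.
  by rewrite ler_piMr ?mulr_ge0// /q; lra.
have n2 : `|l * a * p| <= s * a.
  rewrite !normrM (ger0_norm a0) (ger0_norm (ltW p0)) -/s.
  by rewrite ler_piMr ?mulr_ge0.
have := expR_le_quad_norm n1; have := expR_le_quad_norm n2.
set E := expR (s * a) => h2 h1.
have k1 : a ^+ 2 * p <= 16 / 25 by exact: sqrM_expRN_le.
have k2 : r ^+ 2 * (a ^+ 2 * p * E) <= 16 / 25.
  have := @sqrM_expRN_le _ (r * a) (mulr_ge0 (ltW r0) a0).
  suff -> : expR (- (r * a)) = p * E by rewrite exprMn !mulrA.
  by rewrite /p /E -expRD; congr expR; rewrite /r; ring.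
have E0 : 0 < E := expR_gt0 _.
apply: (@le_trans _ _ (1 + l ^+ 2 / 6 * (2 * (a ^+ 2 * p) + a ^+ 2 * p * E))).
  (* Averaging [h1] and [h2] with weights [p] and [q] cancels the linear terms, and the squares add
     up to [l ^+ 2 * a ^+ 2 * p * q] because [p + q = 1]. *)
  apply: (@le_trans _ _ (1 + l ^+ 2 / 6 * (2 + E) * (a ^+ 2 * p * q))).
    have := ler_wpM2l (ltW p0) h1.
    have := ler_wpM2l q0 h2.
    set e1 := q * _; set e2 := p * expR _ => g1 g2.
    apply: (le_trans (lerD g2 g1)).
    by rewrite le_eqVlt; apply/orP; left; apply/eqP; rewrite /q; field.
  rewrite lerD2l -[_ * (2 + E) * _]mulrA; apply: ler_wpM2l.
    by rewrite divr_ge0// sqr_ge0.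
  have : 0 <= a ^+ 2 * p by rewrite mulr_ge0 ?sqr_ge0// ltW.
  have : q <= 1 by rewrite /q; lra.
  set b := a ^+ 2 * p; move=> q1 b0.
  rewrite -[b * E]mulrC -mulrDl; apply: ler_wpM2l; first by lra.
  by rewrite ler_piMr.
rewrite lerD2l -mulrA ler_wpM2l ?sqr_ge0//.
set b := a ^+ 2 * p in k1 k2 *; set c := b * E in k2 *.
have rr : 0 < r ^+ 2 by rewrite exprn_gt0.
have k3 : c <= 16 / 25 / r ^+ 2 by rewrite ler_pdivlMr// mulrC.
(* What remains is [2 * b + c <= 3 * v], which follows from [32/25 + 16/25 * v ^+ 2 <= 3 * v]. By
   convexity in [v] it holds on [[1, 4]] once it holds at both ends; at 4 it reads 11.52 <= 12,
   hence the threshold [r = 1/4]. *)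
rewrite invfM; set v := r^-1; have rv : r * v = 1 by rewrite mulfV// gt_eqF.
have v0 : 0 < v by rewrite invr_gt0.
have v4 : v <= 4 by nra.
have v1 : 1 <= v by rewrite /r in rv r0 *; nra.
rewrite -exprVn -/v in k3.
nra.
Qed.

Lemma bernoulli_log_mgf_le (R : realType) (p l : R) : 0 <= p <= 1 -> `|l| < 1 ->
  \sum_(b : bool) bernoulli_pmf p b * expR (l * ((b%:R - p) * ln p)) <=
  expR (l ^+ 2 / (2 * (1 - `|l|))).
Proof.
move=> /andP[p0 p1] l1; rewrite big_bool /bernoulli_pmf /=.
(* At [p = 0] the substitution [p = expR (- a)] fails; there [ln 0 = 0] makes the sum equal to 1. *)
have [->|pn0] := eqVneq p 0.
  rewrite ln0// !mulr0 expR0 !mulr1 add0r subr0.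
  rewrite (le_trans _ (expR_ge1Dx _))// lerDl.
  by rewrite divr_ge0 ?sqr_ge0// mulr_ge0// subr_ge0 ltW.
have pp : 0 < p by rewrite lt0r pn0.
have a0 : 0 <= - ln p by rewrite oppr_ge0 ln_le0.
have := ber_log_mgf_le a0 l1; rewrite opprK lnK//; apply: le_trans.
by rewrite le_eqVlt; apply/orP; left; apply/eqP;
  congr (_ * expR _ + _ * expR _); ring.
Qed.

(** The indicator of [t <= |s|] is at most [expR (- (l * t)) * (expR (l * s) + expR (- l * s))]. For
    [s] a sum over [i], distributivity factors each weighted sum over [f] into a product over
    [i]. *)
Lemma sum_prod_chernoff (R : realType) (I : finType) (w y : I -> bool -> R)
    (l t : R) : (forall i b, 0 <= w i b) -> 0 <= l ->
  \sum_(f : {ffun I -> bool} | t <= `|\sum_i y i (f i)|) \prod_i w i (f i) <=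
  expR (- (l * t)) * (\prod_i \sum_b w i b * expR (l * y i b) +
                      \prod_i \sum_b w i b * expR (- l * y i b)).
Proof.
move=> w0 l0; rewrite !bigA_distr_bigA -big_split/= mulr_sumr big_mkcond/=.
apply: ler_sum => f _; rewrite !big_split/= -!expR_sum -!mulr_sumr -mulrDr.
set s := \sum_i _; set u := \prod_i _.
have u0 : 0 <= u by exact: prodr_ge0.
rewrite mulrCA mulrDr -!expRD; case: ifPn => [|_]; last first.
  by rewrite mulr_ge0// addr_ge0 ?expR_ge0.
rewrite ler_normr => ts; rewrite ler_peMr//.
have {}ts : 0 <= - (l * t) + l * s \/ 0 <= - (l * t) + - l * s.
  by case/orP: ts => ts; [left|right]; nra.
have e1 := expR_ge0 (- (l * t) + l * s).
have e2 := expR_ge0 (- (l * t) + - l * s).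
by case: ts; rewrite -ler_expR expR0; lra.
Qed.

(** * Passage from the probability space to finite sums over Boolean vectors *)

Section Ber.
Context d (T : measurableType d) (R : realType) (P : probability T R).

Lemma Ber_point (X : {RV P >-> R}) (p : R) (b : bool) :
  0 <= p <= 1 -> is_Ber X p ->
  P (X @^-1` [set b%:R]) = (bernoulli_pmf p b)%:E.
Proof.
move=> p01 XB; transitivity (distribution P X [set (b%:R : R)]) => //.
rewrite XB// /pushforward /bernoulli_prob p01.
rewrite (_ : _ @^-1` _ = [set b]) ?fsbig_set1//.
apply/seteqP; split => [c|c ->]//=.
by case: c b => [] [] //= /eqP; rewrite ?oner_eq0// eq_sym oner_eq0.
Qed.

Lemma Ber_mgf (X : {RV P >-> R}) (p l : R) : 0 <= p <= 1 -> is_Ber X p ->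
  'M_P (centered_log X p) l =
  (\sum_(b : bool) bernoulli_pmf p b * expR (l * ((b%:R - p) * ln p)))%:E.
Proof.
move=> p01 XB; rewrite /mmt_gen_fun unlock.
pose g (x : R) : \bar R := (expR (l * ((x - p) * ln p)))%:E.
have mg : measurable_fun [set: R] g.
  apply/measurable_EFinP; apply: measurableT_comp => //.
  apply: measurable_funM => //; apply: measurable_funM => //.
  exact: measurable_funB.
have g0 x : (0 <= g x)%E by rewrite lee_fin expR_ge0.
have mb : measurable_fun [set: bool] (fun b : bool => b%:R : R) by [].
transitivity (\int[P]_w (g \o X) w)%E.
  by apply: eq_integral => w _ /=; rewrite /g mulrC.
rewrite -ge0_integral_distribution//.
transitivity (\int[pushforward (bernoulli_prob p) (fun b : bool => b%:R : R)]_x g x)%E.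
  by apply: eq_measure_integral => A mA _; exact: XB.
rewrite ge0_integral_pushforward// preimage_setT integral_bernoulli_prob//=.
  by rewrite big_bool.
Qed.

Lemma independent_Ber_le (I : finType) (p : I -> R) (X : I -> {RV P >-> R})
    (Q : (I -> R) -> bool) :
  (forall i, 0 <= p i <= 1) -> (forall i, is_Ber (X i) (p i)) ->
  mutually_independent X -> measurable [set w | Q (fun i => X i w)] ->
  (P [set w | Q (fun i => X i w)] <=
   (\sum_(f : {ffun I -> bool} | Q (fun i => (f i)%:R))
      \prod_i bernoulli_pmf (p i) (f i))%:E)%E.
Proof.
move=> p01 XB Xi mE; set E := [set w | _] in mE *.
pose C (f : {ffun I -> bool}) : set T :=
  \bigcap_(i in [set` [set: I]%SET]) (X i @^-1` [set (f i)%:R]).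
have mC f : measurable (C f).
  apply: fin_bigcap_measurable => [|i _]; first exact: finite_finset.
  exact: measurable_funPTI.
have PC f : P (C f) = (\prod_i bernoulli_pmf (p i) (f i))%:E.
  rewrite Xi// -prodEFin; apply: eq_big => [i|i _]; first by rewrite inE.
  exact: Ber_point.
have CX f w i : C f w -> X i w = (f i)%:R by move=> /(_ i); apply; rewrite /= inE.
(* The cells where Q fails lie in the complement of E, so bounding P (~` E) from
   below by their total mass avoids treating the null set outside all cells. *)
pose B := [set` [pred f : {ffun I -> bool} | ~~ Q (fun i => (f i)%:R)]].
have tC : trivIset B C.
  apply/trivIsetP => f g _ _ /eqP fg; rewrite -subset0 => w [fw gw].
  apply: fg; apply/ffunP => i; have := CX _ _ i gw; rewrite (CX _ _ i fw).
  by case: (f i) (g i) => [] [] //= /eqP; rewrite ?oner_eq0// eq_sym oner_eq0.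
have PB : P (\bigcup_(f in B) C f) =
    (\sum_(f : {ffun I -> bool} | ~~ Q (fun i => (f i)%:R))
      \prod_i bernoulli_pmf (p i) (f i))%:E.
  rewrite measure_fin_bigcup//; last exact: finite_finset.
  rewrite -(@bigfs _ _ _ _ (index_enum _)) ?index_enum_uniq//; last first.
    by move=> f _; rewrite mem_index_enum.
  by rewrite -sumEFin; apply: eq_bigr => f _; exact: PC.
have BE : \bigcup_(f in B) C f `<=` ~` E.
  move=> w [f /negP Bf fw] Ew; apply: Bf; move: Ew; rewrite /E/=.
  by congr (is_true (Q _)); apply/funext => i; exact: CX.
have : (P (\bigcup_(f in B) C f) <= P (~` E))%E.
  apply: le_measure => //; rewrite inE.
    by apply: fin_bigcup_measurable.
  exact: measurableC.
rewrite PB probability_setC// -(fineK (fin_num_measure P _ mE)) -EFinB !lee_fin.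
(* The cell masses sum to 1, so the lower bound for the complement of [E] becomes the upper bound
   for [E]. *)
suff : \sum_(f : {ffun I -> bool}) \prod_i bernoulli_pmf (p i) (f i) = 1.
  by rewrite (bigID (fun f : {ffun I -> bool} => Q (fun i => (f i)%:R)))/=; lra.
rewrite -(bigA_distr_bigA (fun i => bernoulli_pmf (p i))) big1// => i _.
by rewrite big_bool /bernoulli_pmf/= subrKC.
Qed.

End Ber.

Theorem theorem1 (d : measure_display) (T : measurableType d) (R : realType)
    (P : probability T R) (n : nat) (p : 'I_n -> R) (X : 'I_n -> {RV P >-> R})
    (n_ge1 : (1 <= n)%N)
    (p01 : forall i, 0 <= p i <= 1)
    (XBer : forall i, is_Ber (X i) (p i))
    (Xind : mutually_independent X) :
  (forall (i : 'I_n) (lambda : R), `|lambda| < 1 ->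
     ('M_P (centered_log (X i) (p i)) lambda
        <= (expR (lambda ^+ 2 / (2 * (1 - `|lambda|))))%:E)%E)
  /\
  (forall t : R, 0 < t ->
     (P [set w | (t <= `|\sum_(i < n) centered_log (X i) (p i) w|)%R]
        <= (2 * expR (- (t ^+ 2 / (2 * (n%:R + t)))))%:E)%E).
Proof.
split=> [i l l1|t t0].
  by rewrite Ber_mgf// lee_fin bernoulli_log_mgf_le.
pose Q (x : 'I_n -> R) := t <= `|\sum_i (x i - p i) * ln (p i)|.
have mE : measurable [set w | Q (fun i => X i w)].
  have mS : measurable_fun setT (fun w => `|\sum_i (X i w - p i) * ln (p i)|).
    apply: measurableT_comp => //; apply: measurable_sum => i.
    by apply: measurable_funM => //; exact: measurable_funB.
  have := mS measurableT _ (measurable_itv `[t, +oo[).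
  by congr measurable; apply/seteqP; split=> w /=; rewrite in_itv/= andbT // => -[].
apply: le_trans (independent_Ber_le p01 XBer Xind mE) _.
have n0 : 0 < n%:R :> R by rewrite ltr0n.
(* This choice gives [1 - l = n / (n + t)], so [n * l ^+ 2 / (2 * (1 - l)) = l * t / 2] and the
   Chernoff exponent is exactly [- (l * t) / 2], the one claimed. Positivity of [n] ensures
   [l < 1]. *)
pose l := t / (n%:R + t).
have l0 : 0 < l by rewrite divr_gt0// addr_gt0.
have l1 : l < 1 by rewrite ltr_pdivrMr ?addr_gt0// mul1r ltrDr.
pose w (i : 'I_n) b := bernoulli_pmf (p i) b.
pose y (i : 'I_n) (b : bool) : R := (b%:R - p i) * ln (p i).
have w0 i b : 0 <= w i b by exact: bernoulli_pmf_ge0.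
rewrite lee_fin; apply: le_trans (sum_prod_chernoff y t w0 (ltW l0)) _.
have prod_le (m : R) : `|m| = l ->
    \prod_i \sum_b w i b * expR (m * y i b) <=
    expR (n%:R * (l ^+ 2 / (2 * (1 - l)))).
  move=> ml; have m1 : `|m| < 1 by rewrite ml.
  have m2 : m ^+ 2 = l ^+ 2 by rewrite -(real_normK (num_real m)) ml.
  rewrite mulrC expRM_natr -[X in _ ^+ X]card_ord -prodr_const.
  apply: ler_prod => i _; rewrite sumr_ge0 => [/=|b _].
    by have := bernoulli_log_mgf_le (p01 i) m1; rewrite ml m2.
  by rewrite mulr_ge0 ?expR_ge0.
have le1 := prod_le l (gtr0_norm l0).
have le2 := prod_le (- l); rewrite normrN in le2; have {}le2 := le2 (gtr0_norm l0).
apply: le_trans (ler_wpM2l (expR_ge0 _) (lerD le1 le2)) _.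
rewrite mulrDr -expRD -mulr2n -[_ *+ 2]mulr_natl ler_pM2l// ler_expR le_eqVlt.
apply/orP; left; apply/eqP; rewrite /l.
by field; rewrite addrK !gt_eqF ?addr_gt0.
Qed.
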